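(* Let $m=10+12q$ with $q=2d$ for a nonnegative integer $d$, and let $t=t(q)$. The minimal decomposition of $\mathbb{Z}_2$ for the Fibonacci polynomial $F_m$ is $$\mathbb{Z}_2=\{0\}\sqcup\Bigl(\bigl(\bigcup_{k=0}^{3}A_k\bigr)\cup\bigl(\bigcup_{n\ge 1}\bigcup_{k=0}^{2^{t+1}-1}M_{n,k}\bigr)\Bigr),$$ where $A_k=(1+4k+2^4\mathbb{Z}_2)\cup(7-4k+2^4\mathbb{Z}_2)$ and $M_{n,k}=(1+2k)2^n+2^{n+t+2}\mathbb{Z}_2$. Here $\{0\}$ is the set of a fixed point, and the $A_k$'s and $M_{n,k}$'s are the minimal components.
   Context: $\mathbb{Z}_2$ is the ring of 2-adic integers with the 2-adic metric. The Fibonacci polynomials are defined by $F_0(x)=0$, $F_1(x)=1$, $F_m(x)=xF_{m-1}(x)+F_{m-2}(x)$ for $m\ge 2$. For a nonnegative integer $q$ with binary expansion $q=\sum_{i\ge 0}c_i2^i$, $c_i\in\{0,1\}$ (with $c_i=0$ for all large $i$), define $t(q)=\min\{i\ge 0: c_i=c_{i+1}\}$. For a polynomial $f$ over $\mathbb{Z}_2$, a minimal decomposition of $\mathbb{Z}_2$ for $f$ is a decomposition $\mathbb{Z}_2=\mathcal P\sqcup\mathcal M\sqcup\mathcal B$ (some parts possibly empty) in which: $\mathcal P$ is the finite set consisting of all periodic points of $f$; $\mathcal M=\bigsqcup_i\mathcal M_i$ is the union of all (at most countably many) clopen $f$-invariant sets $\mathcal M_i$ (the minimal components), each a finite union of balls,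 such that each $f:\mathcal M_i\to\mathcal M_i$ is minimal (every orbit is dense in $\mathcal M_i$); and each point of $\mathcal B$ lies in the attracting basin of a periodic orbit or of a minimal subsystem. *)

(* Defs.v *)
From HB Require Import structures.
From mathcomp Require Import all_boot all_order all_algebra.
From mathcomp Require Import all_classical all_reals all_analysis.

Set Implicit Arguments.
Unset Strict Implicit.
Unset Printing Implicit Defensive.

Import Order.TTheory GRing.Theory Num.Theory.

Local Open Scope classical_set_scope.
Local Open Scope ring_scope.

(* 2-adic integers as the inverse limit of the rings Z/2^n: a 2-adic integer
   is a coherent sequence of canonical representatives 0 <= x_n < 2^n. *)
Record adic2 := Adic2 {
  residue :> nat -> int;
  residue_coherent : forall n, residue n = (residue n.+1 %% 2 ^+ n)%Z }.

HB.instance Definition _ := gen_eqMixin adic2.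
HB.instance Definition _ := gen_choiceMixin adic2.

Lemma adic2P (x y : adic2) : (forall n, x n = y n) -> x = y.
Proof.
case: x y => [x xc] [y yc] /= xy.
have E : x = y by apply/funext.
by subst y; congr Adic2; apply: Prop_irrelevance.
Qed.

Lemma modz_pow2S (z : int) n : ((z %% 2 ^+ n.+1)%Z %% 2 ^+ n)%Z = (z %% 2 ^+ n)%Z.
Proof.
by rewrite {2}(divz_eq z (2 ^+ n.+1)) exprS mulrA modzMDl.
Qed.

Lemma residue_mod (x : adic2) n : (x n %% 2 ^+ n)%Z = x n.
Proof. by rewrite residue_coherent modz_mod. Qed.

Lemma residue_le (x : adic2) m n :
  (m <= n)%N -> x m = (x n %% 2 ^+ m)%Z.
Proof.
move=> /subnK <-; elim: (n - m)%N => [|k IH]; first by rewrite add0n residue_mod.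
rewrite IH (residue_coherent x (k + m)) addSn.
move: (x (k + m).+1) => z; rewrite {2}(divz_eq z (2 ^+ (k + m))).
by rewrite exprD mulrA modzMDl.
Qed.

Lemma intr_adic2_coherent (z : int) n :
  (z %% 2 ^+ n)%Z = ((z %% 2 ^+ n.+1)%Z %% 2 ^+ n)%Z.
Proof. by rewrite modz_pow2S. Qed.

Definition adic2_of_int (z : int) : adic2 :=
  Adic2 (intr_adic2_coherent z).

Lemma add_coherent (x y : adic2) n :
  ((x n + y n) %% 2 ^+ n)%Z = (((x n.+1 + y n.+1) %% 2 ^+ n.+1)%Z %% 2 ^+ n)%Z.
Proof. by rewrite modz_pow2S (residue_coherent x n) (residue_coherent y n) modzDm. Qed.

Lemma opp_coherent (x : adic2) n :
  ((- x n) %% 2 ^+ n)%Z = (((- x n.+1) %% 2 ^+ n.+1)%Z %% 2 ^+ n)%Z.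
Proof. by rewrite modz_pow2S (residue_coherent x n) modzNm. Qed.

Lemma mul_coherent (x y : adic2) n :
  ((x n * y n) %% 2 ^+ n)%Z = (((x n.+1 * y n.+1) %% 2 ^+ n.+1)%Z %% 2 ^+ n)%Z.
Proof. by rewrite modz_pow2S (residue_coherent x n) (residue_coherent y n) modzMm. Qed.

Definition adic2_add (x y : adic2) : adic2 := Adic2 (add_coherent x y).
Definition adic2_opp (x : adic2) : adic2 := Adic2 (opp_coherent x).
Definition adic2_mul (x y : adic2) : adic2 := Adic2 (mul_coherent x y).

Lemma adic2_addA : associative adic2_add.
Proof. by move=> x y z; apply: adic2P => n /=; rewrite modzDml modzDmr addrA. Qed.
Lemma adic2_addC : commutative adic2_add.
Proof. by move=> x y; apply: adic2P => n /=; rewrite addrC. Qed.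
Lemma adic2_add0 : left_id (adic2_of_int 0) adic2_add.
Proof. by move=> x; apply: adic2P => n /=; rewrite mod0z add0r residue_mod. Qed.
Lemma adic2_addN : left_inverse (adic2_of_int 0) adic2_opp adic2_add.
Proof. by move=> x; apply: adic2P => n /=; rewrite modzDml addNr. Qed.

HB.instance Definition _ := GRing.isZmodule.Build adic2
  adic2_addA adic2_addC adic2_add0 adic2_addN.

Lemma adic2_mulA : associative adic2_mul.
Proof. by move=> x y z; apply: adic2P => n /=; rewrite modzMml modzMmr mulrA. Qed.
Lemma adic2_mulC : commutative adic2_mul.
Proof. by move=> x y; apply: adic2P => n /=; rewrite mulrC. Qed.
Lemma adic2_mul1 : left_id (adic2_of_int 1) adic2_mul.
Proof. by move=> x; apply: adic2P => n /=; rewrite modzMml mul1r residue_mod. Qed.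
Lemma adic2_mulD : left_distributive adic2_mul adic2_add.
Proof. by move=> x y z; apply: adic2P => n /=; rewrite modzMml modzDm mulrDl. Qed.
Lemma adic2_1neq0 : adic2_of_int 1 != 0.
Proof. by apply/eqP => /(congr1 (fun x : adic2 => x 1%N)). Qed.

HB.instance Definition _ := GRing.Zmodule_isComNzRing.Build adic2
  adic2_mulA adic2_mulC adic2_mul1 adic2_mulD adic2_1neq0.

(* Since x_n = 0 iff 2^n divides x, the least n with x_(n+1) <> 0 is the
   2-adic valuation of x <> 0. *)
Definition adic2_norm (x : adic2) : rat :=
  if pselect (exists n, x n.+1 != 0) is left x_neq0
  then 2 ^- ex_minn x_neq0 else 0.

Lemma residue0 (x : adic2) : x 0%N = 0.
Proof. by rewrite -residue_mod expr0 modz1. Qed.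

Lemma adic2_norm_ge0 x : 0 <= adic2_norm x.
Proof. by rewrite /adic2_norm; case: pselect => // ?; rewrite invr_ge0 exprn_ge0. Qed.

Lemma adic2_norm_eq0 x : adic2_norm x = 0 -> x = 0.
Proof.
rewrite /adic2_norm; case: pselect => [h /eqP|h _].
  by rewrite invr_eq0 expf_eq0 andbF.
apply: adic2P => -[|n] /=; first by rewrite residue0 mod0z.
by rewrite mod0z; apply: contrapT => /eqP xn; apply: h; exists n.
Qed.

Lemma adic2_norm_le x n : (adic2_norm x <= 2 ^- n) = (x n == 0).
Proof.
rewrite /adic2_norm; case: pselect => [h|h].
  case: ex_minnP => m xm mmin.
  rewrite lef_pV2 ?posrE ?exprn_gt0// ler_eXn2l//.
  apply/idP/idP => [nm|].
    case: n nm => [|n] nm; first by rewrite residue0.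
    by apply: contraTT nm => /mmin; rewrite -ltnNge.
  apply: contraTT; rewrite -ltnNge => mn; apply: contra xm => /eqP xn.
  by rewrite (residue_le x mn) xn mod0z.
rewrite invr_ge0 exprn_ge0//; apply/esym/eqP.
case: n => [|n]; first by rewrite residue0.
by apply: contrapT => /eqP xn; apply: h; exists n.
Qed.

Lemma adic2_normE x : adic2_norm x = 0 \/ exists n, adic2_norm x = 2 ^- n.
Proof. by rewrite /adic2_norm; case: pselect => [h|]; [right; exists (ex_minn h)|left]. Qed.

Lemma adic2_norm0 : adic2_norm 0 = 0.
Proof.
rewrite /adic2_norm; case: pselect => // h; exfalso.
by case: h => n /=; rewrite mod0z eqxx.
Qed.

Lemma adic2_normN x : adic2_norm (- x) = adic2_norm x.
Proof.
suff le z : adic2_norm (- z) <= adic2_norm z.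
  by apply/eqP; rewrite eq_le le /= -{1}(opprK x) le.
have [/adic2_norm_eq0 ->|[n zn]] := adic2_normE z; first by rewrite oppr0.
rewrite zn adic2_norm_le /=.
have: z n == 0 by rewrite -adic2_norm_le zn.
by move=> /eqP ->; rewrite oppr0 mod0z.
Qed.

Lemma adic2_norm_max x y n :
  adic2_norm x <= 2 ^- n -> adic2_norm y <= 2 ^- n -> adic2_norm (x + y) <= 2 ^- n.
Proof.
by rewrite !adic2_norm_le /= => /eqP -> /eqP ->; rewrite addr0 mod0z.
Qed.

Lemma adic2_normD x y : adic2_norm (x + y) <= adic2_norm x + adic2_norm y.
Proof.
wlog xy : x y / adic2_norm x <= adic2_norm y.
  move=> H; have [/H//|/ltW/H] := leP (adic2_norm x) (adic2_norm y).
  by rewrite addrC [leRHS]addrC.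
apply: (@le_trans _ _ (adic2_norm y)); last by rewrite lerDr adic2_norm_ge0.
have [y0|[n yn]] := adic2_normE y; last by rewrite yn adic2_norm_max// -yn.
have x0 : adic2_norm x = 0.
  by apply/eqP; rewrite eq_le adic2_norm_ge0 andbT -y0.
by rewrite (adic2_norm_eq0 y0) (adic2_norm_eq0 x0) addr0.
Qed.

Definition adic2_dist (x y : adic2) : rat := adic2_norm (x - y).

Lemma adic2_distxx x : adic2_dist x x = 0.
Proof. by rewrite /adic2_dist subrr adic2_norm0. Qed.
Lemma adic2_dist_eq0 x y : adic2_dist x y = 0 -> x = y.
Proof. by move=> /adic2_norm_eq0/subr0_eq. Qed.
Lemma adic2_dist_sym x y : adic2_dist x y = adic2_dist y x.
Proof. by rewrite /adic2_dist -adic2_normN opprB. Qed.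
Lemma adic2_dist_triangle y x z : adic2_dist x z <= adic2_dist x y + adic2_dist y z.
Proof. by rewrite /adic2_dist -(subrKA y x) adic2_normD. Qed.

(* 2-adic distances are rational numbers, so the metric is taken over rat. *)
HB.instance Definition _ := isMetric.Build rat adic2
  adic2_distxx adic2_dist_eq0 adic2_dist_sym adic2_dist_triangle.

Fixpoint fibonacci_pair (R : nzRingType) (m : nat) : {poly R} * {poly R} :=
  if m is m'.+1 then
    let: (a, b) := fibonacci_pair R m' in (b, 'X * b + a)
  else (0, 1).

Definition fibonacci_poly (R : nzRingType) (m : nat) : {poly R} :=
  (fibonacci_pair R m).1.

Lemma fibonacci_poly0 (R : nzRingType) : fibonacci_poly R 0 = 0.
Proof. by []. Qed.
Lemma fibonacci_poly1 (R : nzRingType) : fibonacci_poly R 1 = 1.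
Proof. by []. Qed.
Lemma fibonacci_polySS (R : nzRingType) m :
  fibonacci_poly R m.+2 = 'X * fibonacci_poly R m.+1 + fibonacci_poly R m.
Proof. by rewrite /fibonacci_poly /=; case: fibonacci_pair. Qed.

Definition binary_digit (q i : nat) : bool := odd (q %/ 2 ^ i)%N.

Lemma equal_digits_exist q : exists i, binary_digit q i == binary_digit q i.+1.
Proof.
have small i : (q <= i)%N -> binary_digit q i = false.
  move=> qi; rewrite /binary_digit divn_small//.
  exact: leq_ltn_trans qi (ltn_expl _ _).
by exists q; rewrite !small.
Qed.

Definition first_equal_digits (q : nat) : nat := ex_minn (equal_digits_exist q).

Section Decomposition.
Variable f : adic2 -> adic2.

Definition orbit_of (x : adic2) : set adic2 := [set iter n f x | n in [set: nat]].

Definition periodic_points : set adic2 :=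
  [set x | exists2 n, (0 < n)%N & iter n f x = x].

Definition invariant_set (S : set adic2) := f @` S `<=` S.

Definition minimal_on (S : set adic2) :=
  forall x, S x -> S `<=` closure (orbit_of x).

Definition finite_union_of_balls (S : set adic2) :=
  exists D : set (adic2 * rat), [/\ finite_set D,
    (forall b, D b -> 0 < b.2) & S = \bigcup_(b in D) ball b.1 b.2].

Definition minimal_component (S : set adic2) :=
  [/\ S !=set0, clopen S, finite_union_of_balls S, invariant_set S & minimal_on S].

Definition attracted_to (x : adic2) (S : set adic2) :=
  forall e : rat, 0 < e ->
    \forall n \near \oo, exists2 y, S y & ball y e (iter n f x).

End Decomposition.

(* The index type I of the components is countable, possibly finite or empty. *)
Definition minimal_decomposition (I : countType) (f : {poly adic2})
    (P : set adic2) (M : I -> set adic2) (B : set adic2) :=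
  [/\ [/\ P `|` \bigcup_i M i `|` B = setT, P `&` \bigcup_i M i = set0,
          P `&` B = set0 & \bigcup_i M i `&` B = set0],
      finite_set P /\ P = periodic_points (horner f),
      trivIset setT M,
      forall S, minimal_component (horner f) S <-> exists i, M i = S
    & forall x, B x -> (exists2 p, periodic_points (horner f) p &
                          attracted_to (horner f) x (orbit_of (horner f) p))
                       \/ (exists i, attracted_to (horner f) x (M i))].

(* a + 2^n Z_2 *)
Definition adic2_coset (a : adic2) (n : nat) : set adic2 :=
  [set a + 2 ^+ n * z | z in [set: adic2]].

Definition A_ (k : nat) : set adic2 :=
  adic2_coset (1 + 4 * k%:R) 4 `|` adic2_coset (7 - 4 * k%:R) 4.

Definition M_ (t n k : nat) : set adic2 :=
  adic2_coset ((1 + 2 * k%:R) * 2 ^+ n) (n + t + 2).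

(* The index n : nat stands for the exponent n.+1 >= 1. *)
Definition component (t : nat) (i : 'I_4 + nat * 'I_(2 ^ t.+1)) : set adic2 :=
  match i with
  | inl k => A_ k
  | inr (n, k) => M_ t n.+1 k
  end.

(* Main.v *)
Require Import Defs.
From mathcomp Require Import all_boot all_order all_algebra.
From mathcomp Require Import all_classical all_reals all_analysis.
From mathcomp Require Import zify ring.

(** Write [f] for the Fibonacci polynomial of index [m = 10 + 12 q], [q] even,
    so that [m = 2] mod [8].

    Minimality comes from one principle ([odometer_dense]). Suppose that [g]
    maps a ball of radius [2^-N] to itself, moves each point of it by exactly
    [2^N] times a unit, and that its increments between points [x] and [y] are
    [x - y] up to a factor [1 + 4 w]. Then the displacements at [x] and at
    [g x] agree mod [2^(N+2)] and add up to [2^(N+1)] times a unit, so [g \o g]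
    is of the same kind with [N + 1] in place of [N]. Hence the [2^k]-th iterate
    moves every point by exactly [2^(N+k)] times a unit: orbits can be steered
    to agree with a target one binary digit at a time, hence are dense, and no
    point is periodic. For polynomials the condition on increments is a
    condition on the derivative, and for [N >= 2] it can be read off from the
    values mod 16 at [x] and [x + 4] ([odometer_poly]).

    On even points, the identity
      [F_(4k+2) - x = F_(2k) (F_(2k+3) + F_(2k+1))], with [k = 3 q + 2],
    reduces the displacement to [F_(2k)], and the doubling formula for [F_(4k)]
    shows that each factor 2 of [k] contributes exactly one factor 2 to
    [F_(2k)]. The binary digits of [-2/3] alternate, so [q] agrees with it
    exactly as long as its own digits alternate: the 2-adic valuation of
    [3 q + 2] is [t + 1] ([first_equal_digits_spec]). Altogether [f x - x] is
    [2^(t+2) x] times a unit, so that each ball [M_ t n k] carries such a map.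

    On odd points everything is decided mod 32, where the Fibonacci recursion
    has period 48 in the index: [f x = 8 - x] mod 16 and [f (f x) = x + 16]
    mod 32. So [f] exchanges the two balls of [A_ k], and the principle applies
    to [f \o f] on each of them.

    These sets partition the nonzero 2-adic integers, so all periodic points
    other than 0 are excluded, and a minimal component, being open, meets and
    then equals one of them. *)

Set Implicit Arguments.
Unset Strict Implicit.
Unset Printing Implicit Defensive.

Import Order.TTheory GRing.Theory Num.Theory.

Local Open Scope classical_set_scope.
Local Open Scope ring_scope.

(** * Congruences and odd parts of 2-adic integers *)

Lemma natr_residue (r n : nat) : (r%:R : adic2) n = (r%:Z %% 2 ^+ n)%Z.
Proof.
elim: r => [|r IHr] //.
by rewrite -addn1 natrD PoszD /= IHr modzDm.
Qed.

Lemma pow2_residue (m n : nat) : (2 ^+ m : adic2) n = (2 ^+ m %% 2 ^+ n)%Z.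
Proof. by rewrite -natrX natr_residue -!natz natrX. Qed.

(** The quotient is built level by level: its residue mod [2^k] is read off from
    the residue of [x] mod [2^(n+k)], whose division by [2^n] is exact. *)
Lemma exact_quotient (x : adic2) n : x n = 0 -> exists z, x = 2 ^+ n * z.
Proof.
move=> xn0.
have dvdx k : (2 ^+ n %| x (n + k)%N)%Z.
  by apply/dvdz_mod0P; rewrite -(residue_le x (leq_addr k n)).
have coh k : (x (n + k)%N %/ 2 ^+ n)%Z
           = ((x (n + k.+1)%N %/ 2 ^+ n)%Z %% 2 ^+ k)%Z.
  rewrite addnS residue_coherent -addnS.
  have /divzK e := dvdx k.+1.
  by rewrite -[in LHS]e mulrC exprD -mulz_modr ?exprn_gt0// mulKz// expf_neq0.
exists (Adic2 coh); apply: adic2P => k.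
change (x k = ((2 ^+ n : adic2) k * (x (n + k)%N %/ 2 ^+ n)%Z %% 2 ^+ k)%Z).
rewrite pow2_residue modzMml mulrC (divzK (dvdx k)).
exact: residue_le (leq_addl n k).
Qed.

Lemma residueD (x y : adic2) n : (x + y) n = ((x n + y n) %% 2 ^+ n)%Z.
Proof. by []. Qed.

Lemma residueN (x : adic2) n : (- x) n = ((- x n) %% 2 ^+ n)%Z.
Proof. by []. Qed.

Lemma residueM (x y : adic2) n : (x * y) n = ((x n * y n) %% 2 ^+ n)%Z.
Proof. by []. Qed.

Lemma residue_subr_eq0 (x y : adic2) n : ((x - y) n == 0) = (x n == y n).
Proof.
rewrite residueD residueN modzDmr -[x n in RHS]residue_mod -[y n in RHS]residue_mod.
by rewrite eqz_mod_dvd; apply/eqP/idP => /dvdz_mod0P.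
Qed.

(** The bridge between the inverse limit and ring computations: equality of
    the residues of level [n] is congruence mod [2^n]. *)
Lemma residue_eqP (x y : adic2) n : x n = y n <-> exists z, x = y + 2 ^+ n * z.
Proof.
split=> [/eqP|[z ->]].
  rewrite -residue_subr_eq0 => /eqP /exact_quotient [z e].
  by exists z; rewrite -e addrC subrK.
by rewrite residueD residueM pow2_residue modzz mul0r mod0z addr0 residue_mod.
Qed.

Lemma eq_residue_le (x y : adic2) m n : (m <= n)%N -> x n = y n -> x m = y m.
Proof. by move=> mn e; rewrite !(residue_le _ mn) e. Qed.

Lemma even_or_odd (x : adic2) : (exists z, x = 2 * z) \/ (exists z, x = 1 + 2 * z).
Proof.
have : x 1%N = 0 \/ x 1%N = 1.
  have := residue_mod x 1; rewrite expr1 => <-.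
  by have := @modz_ge0 (x 1%N) 2 isT; have := @ltz_pmod (x 1%N) 2 isT; lia.
case=> e; [left|right].
  by have [z ->] := exact_quotient e; exists z; rewrite expr1.
have /residue_eqP[z ->] : x 1%N = (1 : adic2) 1%N by rewrite e.
by exists z; rewrite expr1.
Qed.

(** This pair of residues pins down the exponent [n], as the odd factor is
    a unit. *)
Lemma pow2_odd_residue (n : nat) (z : adic2) :
  (2 ^+ n * (1 + 2 * z)) n = 0 /\ (2 ^+ n * (1 + 2 * z)) n.+1 != 0.
Proof.
split; first by rewrite residueM pow2_residue modzz mul0r mod0z.
have -> : (2 ^+ n * (1 + 2 * z)) n.+1 = (2 ^+ n : adic2) n.+1.
  by apply/residue_eqP; exists z; rewrite exprS; ring.
rewrite pow2_residue modz_small ?expf_neq0//.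
by rewrite exprn_ge0//= ltr_eXn2l.
Qed.

Lemma pow2_odd_neq0 (n : nat) (z : adic2) : 2 ^+ n * (1 + 2 * z) <> 0.
Proof.
by have [_ /eqP h e] := pow2_odd_residue n z; apply: h; rewrite e /= mod0z.
Qed.

Lemma pow2_odd_decomp (x : adic2) : x <> 0 -> exists n z, x = 2 ^+ n * (1 + 2 * z).
Proof.
move=> x0; have [n xn] : exists n, x n != 0.
  apply: contrapT => h; apply: x0; apply: adic2P => n /=; rewrite mod0z.
  by apply: contrapT => /eqP xn; apply: h; exists n.
elim: n x x0 xn => [|n IH] x x0 xn; first by rewrite residue0 in xn.
have [[y xy]|[z ->]] := even_or_odd x; last by exists 0%N, z; rewrite expr0 mul1r.
have yn : y n != 0.
  apply: contra xn => /eqP /exact_quotient [z yz].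
  by rewrite xy yz mulrA -exprS residueM pow2_residue modzz mul0r mod0z.
have y0 : y <> 0 by move=> y0; move: yn; rewrite y0 /= mod0z.
have [k [z yz]] := IH y y0 yn.
by exists k.+1, z; rewrite xy yz exprS mulrA.
Qed.

(** Torsion-freeness, proved from odd parts: a nonzero difference has the form
    [2^k (1 + 2 z)], and a further power of 2 only raises the exponent. *)
Lemma mulf_pow2_inj (n : nat) : injective (fun x : adic2 => 2 ^+ n * x).
Proof.
move=> x y /= /eqP; rewrite -subr_eq0 -mulrBr => /eqP e.
apply: contrapT => /eqP; rewrite -subr_eq0 => /eqP /pow2_odd_decomp[k [z xyz]].
by move: e; rewrite xyz mulrA -exprD => /pow2_odd_neq0.
Qed.

Lemma pow2_odd_uniq (m n : nat) (y z : adic2) :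
  2 ^+ m * (1 + 2 * y) = 2 ^+ n * (1 + 2 * z) -> m = n /\ y = z.
Proof.
move=> e.
have le a b (u v : adic2) : 2 ^+ a * (1 + 2 * u) = 2 ^+ b * (1 + 2 * v) -> (a <= b)%N.
  move=> ab; rewrite leqNgt; apply/negP => ba.
  have [a0 _] := pow2_odd_residue a u; have [_ /eqP b0] := pow2_odd_residue b v.
  by apply: b0; rewrite -ab (residue_le _ ba) a0 mod0z.
have mn : m = n by apply/eqP; rewrite eqn_leq (le _ _ _ _ e) (le _ _ _ _ (esym e)).
split=> //; subst n; move/mulf_pow2_inj: e => /addrI.
by rewrite -[2]expr1 => /mulf_pow2_inj.
Qed.

Lemma small_remainder (n : nat) (x : adic2) :
  exists2 r : 'I_(2 ^ n), x n = Posz r & exists z, x = r%:R + 2 ^+ n * z.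
Proof.
have x0 : 0 <= x n by rewrite -residue_mod modz_ge0// expf_neq0.
have x1 : x n < 2 ^+ n by rewrite -residue_mod ltz_pmod// exprn_gt0.
have e : x n = Posz `|x n| by rewrite gez0_abs.
have lt : (`|x n| < 2 ^ n)%N by rewrite -ltz_nat -e -natz natrX.
exists (Ordinal lt) => //=; apply/residue_eqP.
by rewrite natr_residue -e residue_mod.
Qed.

(** * Cosets as balls *)

Lemma adic2_cosetE a n : adic2_coset a n = [set x | x n = a n].
Proof.
apply/seteqP; split=> x /=; last by move=> /residue_eqP[z ->]; exists z.
by move=> [z _ <-]; apply/residue_eqP; exists z.
Qed.

Lemma adic2_cosetP (a : adic2) n (x : adic2) : adic2_coset a n x <-> x n = a n.
Proof. by rewrite adic2_cosetE. Qed.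

(** Norms are 0 or powers of 2, so [< 2^-n] means [<= 2^-(n+1)]; hence the
    shift of the exponent. *)
Lemma ball_cosetE a n : ball a (2 ^- n) = adic2_coset a n.+1.
Proof.
rewrite adic2_cosetE ballEmdist; apply/seteqP; split=> x /= h; last first.
  have : adic2_norm (a - x) <= 2 ^- n.+1.
    by rewrite adic2_norm_le residue_subr_eq0 h.
  by move=> /le_lt_trans; apply; rewrite ltf_pV2 ?posrE ?exprn_gt0// ltr_eXn2l.
apply/esym/eqP; rewrite -residue_subr_eq0 -adic2_norm_le.
have {h} : adic2_norm (a - x) < 2 ^- n := h.
have [->|[k ->]] := adic2_normE (a - x); first by rewrite invr_ge0 exprn_ge0.
by rewrite ltf_pV2 ?lef_pV2 ?posrE ?exprn_gt0// ltr_eXn2l// ler_eXn2l.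
Qed.

Lemma nbhs_adic2P (x : adic2) (B : set adic2) :
  nbhs x B <-> exists n, adic2_coset x n `<=` B.
Proof.
split=> [/nbhs_ballP[e /= e0 eB]|[n nB]].
  have [n ne] : exists n : nat, 2 ^- n <= e.
    exists (Num.bound e^-1).
    rewrite -[leRHS]invrK lef_pV2 ?posrE ?exprn_gt0 ?invr_gt0//.
    rewrite ltW// (lt_le_trans (archi_boundP _)) ?invr_ge0 ?ltW//.
    by rewrite -natrX ltr_nat ltn_expl.
  by exists n.+1; rewrite -ball_cosetE; apply: subset_trans eB; exact: le_ball.
apply/nbhs_ballP; exists (2 ^- n); first by rewrite /= invr_gt0 exprn_gt0.
rewrite ball_cosetE => y /adic2_cosetP yx; apply: nB; apply/adic2_cosetP.
exact: eq_residue_le (leqnSn n) yx.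
Qed.

Lemma coset_clopen a n : clopen (adic2_coset a n).
Proof.
split; rewrite -?openC openE => x xa; apply/nbhs_adic2P; exists n.
  by move=> y /adic2_cosetP yx; move: xa => /adic2_cosetP; rewrite -yx => /adic2_cosetP.
by move=> y /adic2_cosetP yx /adic2_cosetP; rewrite yx => /adic2_cosetP.
Qed.

Lemma closure_residues (S : set adic2) (y : adic2) :
  (forall n, exists2 x, S x & x n = y n) -> closure S y.
Proof.
move=> Sy B /nbhs_adic2P[n nB]; have [x Sx xy] := Sy n.
by exists x; split=> //; apply: nB; apply/adic2_cosetP.
Qed.

(** * Odometers *)

Section Odometer.
Implicit Types (S : set adic2) (g : adic2 -> adic2).

(** Modelled on [x |-> x + 2^N] on a coset of [2^N]. The second condition says
    that every displacement has 2-adic valuation exactly [N]; the third one, a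
    derivative that is 1 mod 4, makes the first two conditions survive
    squaring. *)
Definition odometer N S g :=
  [/\ forall x, S x -> S (g x),
      forall x, S x -> exists z, g x = x + 2 ^+ N * (1 + 2 * z)
    & forall x y, S x -> S y -> exists w, g x - g y = (x - y) * (1 + 4 * w)].

(** With [D x := g x - x], the displacement of [g \o g] at [x] is
    [D x + D (g x)], and the condition on increments gives
    [D (g x) = D x (1 + 4 w)]; the sum is twice an odd multiple of [2^N]. *)
Lemma odometer_comp2 N S g : odometer N S g -> odometer N.+1 S (g \o g).
Proof.
move=> [gS gstep glip]; split=> [x Sx|x Sx|x y Sx Sy] /=; first exact: gS (gS _ Sx).
  have [z xz] := gstep _ Sx; have [w /eqP] := glip _ _ (gS _ Sx) Sx.
  rewrite subr_eq => /eqP ->; exists (z + (1 + 2 * z) * w).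
  by rewrite xz exprS; ring.
have [w' e'] := glip _ _ (gS _ Sx) (gS _ Sy); have [w e] := glip _ _ Sx Sy.
by exists (w + w' + 4 * w * w'); rewrite e' e; ring.
Qed.

Lemma odometer_iter N S g k : odometer N S g -> odometer (N + k) S (iter (2 ^ k) g).
Proof.
move=> og; elim: k => [|k /odometer_comp2]; first by rewrite addn0 expn0.
rewrite addnS; congr odometer; apply/funext => x /=.
by rewrite -iterD addnn -mul2n expnS.
Qed.

Lemma iter_stable S g n x : (forall x, S x -> S (g x)) -> S x -> S (iter n g x).
Proof. by move=> gS Sx; elim: n => //= n; apply: gS. Qed.

(** Digit by digit: once an iterate of [x] agrees with [y] mod [2^(N+k)], either
    it already agrees mod [2^(N+k+1)], or [2^k] more iterations, which add an
    odd multiple of [2^(N+k)], correct the next digit. *)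
Lemma odometer_dense N S g (x y : adic2) : odometer N S g -> S x -> S y -> x N = y N ->
  forall k, exists n, iter n g x k = y k.
Proof.
move=> og Sx Sy xyN.
suff H k : exists n, iter n g x (N + k)%N = y (N + k)%N.
  by move=> k; have [n /(eq_residue_le (leq_addl N k))] := H k; exists n.
have [gS _ _] := og.
elim: k => [|k [n e]]; first by exists 0%N; rewrite addn0.
have [_ /(_ _ (iter_stable n gS Sx))[z] ez _] := odometer_iter k og.
have /residue_eqP[w ew] := e.
have [[v ev]|[v ev]] := even_or_odd w.
  by exists n; apply/residue_eqP; exists v; rewrite ew ev addnS exprS; ring.
exists (2 ^ k + n)%N; apply/residue_eqP; exists (1 + v + z).
by rewrite iterD ez ew ev addnS exprS; ring.
Qed.

(** An odd number [n] of steps adds up to [2^N] times an odd number, which is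
    not 0; an even [n] is [n/2] steps of the squared odometer. *)
Lemma odometer_aperiodic N S g n x :
  odometer N S g -> S x -> (0 < n)%N -> iter n g x <> x.
Proof.
elim/ltn_ind: n N g => n IH N g og Sx n0.
have [gS gstep _] := og.
have [n_odd|/even_halfK n_even] := boolP (odd n).
  have [z ->] : exists z, iter n g x = x + 2 ^+ N * (n%:R + 2 * z).
    elim: (n) => [|k [z e]]; first by exists 0; rewrite /= mulr0 addr0 mulr0 addr0.
    have [w] := gstep _ (iter_stable k gS Sx); rewrite e => ew.
    by exists (z + w); rewrite iterS e ew -[k.+1]addn1 natrD; ring.
  have -> : n%:R = 1 + 2 * n./2%:R :> adic2.
    by rewrite -{1}[n]odd_double_half n_odd -mul2n natrD natrM.
  rewrite -addrA -mulrDr => e.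
  by apply: (@pow2_odd_neq0 N (n./2%:R + z)); apply: (addrI x); rewrite addr0.
rewrite -n_even -addnn => e.
have [h0 hn] : (0 < n./2)%N /\ (n./2 < n)%N by lia.
apply: (IH _ hn _ _ (odometer_comp2 og) Sx h0).
rewrite -[RHS]e; elim: (n./2) => //= k ->.
by rewrite addnS.
Qed.

End Odometer.

Lemma horner_taylor1 (p : {poly adic2}) x h :
  exists w, p.[x + h] = p.[x] + h * p^`().[x] + h ^+ 2 * w.
Proof.
elim/poly_ind: p => [|p c [w e]].
  by exists 0; rewrite deriv0 !horner0; ring.
exists (p^`().[x] + w * (x + h)).
by rewrite derivMXaddC !hornerE e; ring.
Qed.

(** Taylor expansion gives [p(x+4) = p(x) + 4 p'(x)] mod 16, so the hypothesis
    at [x] and [x + 4] says that [p'] is 1 mod 4 on the coset. Taylor expansion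
    between points of the coset, whose difference is divisible by 4, then gives
    the condition on increments. *)
Lemma odometer_poly (p : {poly adic2}) (a : adic2) N : (2 <= N)%N ->
  (forall x : adic2, x N = a N -> exists z, p.[x] = x + 2 ^+ N * (1 + 2 * z)) ->
  (forall x : adic2, x N = a N -> p.[x + 4] 4%N = (p.[x] + 4) 4%N) ->
  odometer N (adic2_coset a N) (horner p).
Proof.
rewrite adic2_cosetE => N2 pstep p4; split=> //= [x xa|x y xa ya].
  have [z ->] := pstep _ xa; rewrite -xa.
  by apply/residue_eqP; exists (1 + 2 * z).
have [u pu] : exists u, p^`().[y] = 1 + 4 * u.
  have [w e] := horner_taylor1 p y 4; have /residue_eqP[z] := p4 _ ya.
  rewrite e => /eqP; rewrite -subr_eq0 => /eqP e'.
  exists (z - w); apply: (@mulf_pow2_inj 2) => /=; apply/eqP; rewrite -subr_eq0.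
  by rewrite -[X in _ == X]e'; apply/eqP; ring.
have [h xh] : exists h, x = y + 4 * h.
  have /(eq_residue_le N2)/residue_eqP[h ->] : x N = y N by rewrite xa ya.
  by exists h; rewrite (_ : 2 ^+ 2 = 4 :> adic2)//; ring.
have [w] := horner_taylor1 p y (4 * h); rewrite -xh pu => ->.
by exists (u + h * w); rewrite xh; ring.
Qed.

(** * Minimal components carried by odometers *)

Lemma coset_refl a n : adic2_coset a n a.
Proof. by rewrite adic2_cosetE. Qed.

Lemma coset_finite_union_of_balls a n : finite_union_of_balls (adic2_coset a n.+1).
Proof.
exists [set (a, 2 ^- n)]; split=> [|_ -> /=|]; first exact: finite_set1.
  by rewrite invr_gt0 exprn_gt0.
by rewrite bigcup_set1 /= ball_cosetE.
Qed.

Lemma finite_union_of_balls_setU S T :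
  finite_union_of_balls S -> finite_union_of_balls T ->
  finite_union_of_balls (S `|` T).
Proof.
move=> [D [finD D0 ->]] [E [finE E0 ->]]; exists (D `|` E); split.
- by rewrite finite_setU.
- by move=> b [/D0|/E0].
- by rewrite bigcup_setU.
Qed.

Lemma coset_minimal_component f a N :
  odometer N.+1 (adic2_coset a N.+1) f ->
  minimal_component f (adic2_coset a N.+1).
Proof.
move=> of_; have [fS _ _] := of_; split.
- by exists a; exact: coset_refl.
- exact: coset_clopen.
- exact: coset_finite_union_of_balls.
- by move=> _ [x Sx <-]; exact: fS.
move=> x Sx y Sy; apply: closure_residues => k.
have [n e] : exists n, iter n f x k = y k.
  apply: (odometer_dense of_ Sx Sy).
  by move: Sx Sy; rewrite adic2_cosetE /= => -> ->.
by exists (iter n f x) => //; exists n.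
Qed.

Lemma iter_comp2 (T : Type) (f : T -> T) n x : iter n (f \o f) x = iter n.*2 f x.
Proof. by elim: n => //= n ->. Qed.

(** A target in the same coset is approached by even iterates, a target in the
    other one by odd iterates. *)
Lemma swapped_cosets_minimal_component f a b N :
  (forall x, adic2_coset a N.+1 x -> adic2_coset b N.+1 (f x)) ->
  (forall x, adic2_coset b N.+1 x -> adic2_coset a N.+1 (f x)) ->
  odometer N.+1 (adic2_coset a N.+1) (f \o f) ->
  odometer N.+1 (adic2_coset b N.+1) (f \o f) ->
  minimal_component f (adic2_coset a N.+1 `|` adic2_coset b N.+1).
Proof.
move=> fab fba oa ob; split.
- by exists a; left; exact: coset_refl.
- have [oA cA] := coset_clopen a N.+1; have [oB cB] := coset_clopen b N.+1.
  by split; [exact: openU|exact: closedU].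
- by apply: finite_union_of_balls_setU; exact: coset_finite_union_of_balls.
- by move=> _ [x [/fab|/fba] fx <-]; [right|left].
have dense c x y : odometer N.+1 (adic2_coset c N.+1) (f \o f) ->
    adic2_coset c N.+1 x -> adic2_coset c N.+1 y ->
    forall k, exists n, iter n.*2 f x k = y k.
  move=> oc cx cy k; have [|n] := odometer_dense oc cx cy _ k.
    by move: cx cy; rewrite adic2_cosetE /= => -> ->.
  by rewrite iter_comp2; exists n.
have denseS c x y : odometer N.+1 (adic2_coset c N.+1) (f \o f) ->
    adic2_coset c N.+1 (f x) -> adic2_coset c N.+1 y ->
    forall k, exists n, iter n f x k = y k.
  move=> oc cx cy k; have [n e] := dense _ _ _ oc cx cy k.
  by exists n.*2.+1; rewrite iterSr.
move=> x Sx y Sy; apply: closure_residues => k.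
suff [n e] : exists n, iter n f x k = y k by exists (iter n f x) => //; exists n.
case: Sx Sy => [ax|bx] [ay|by_].
- by have [n e] := dense a x y oa ax ay k; exists n.*2.
- exact: (denseS b x y ob (fab _ ax) by_ k).
- exact: (denseS a x y oa (fba _ bx) ay k).
- by have [n e] := dense b x y ob bx by_ k; exists n.*2.
Qed.

(** * Identities for Fibonacci polynomials *)

Section FibonacciValues.
Variables (R : comNzRingType) (x : R).

Definition fib_value m : R := (fibonacci_poly R m).[x].

Lemma fib_value0 : fib_value 0 = 0.
Proof. by rewrite /fib_value fibonacci_poly0 horner0. Qed.

Lemma fib_value1 : fib_value 1 = 1.
Proof. by rewrite /fib_value fibonacci_poly1 hornerE. Qed.

Lemma fib_valueSS m : fib_value m.+2 = x * fib_value m.+1 + fib_value m.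
Proof. by rewrite /fib_value fibonacci_polySS !hornerE. Qed.

(** The matrix [[x, 1], [1, 0]] has powers with Fibonacci entries; this is the
    product of two such powers. *)
Lemma fib_value_add m n :
  fib_value (m + n).+1 =
  fib_value m.+1 * fib_value n.+1 + fib_value m * fib_value n.
Proof.
elim: m n => [|m IH] n; first by rewrite fib_value0 fib_value1; ring.
by rewrite addSnnS IH !fib_valueSS; ring.
Qed.

(** Cassini's identity at even index: the determinant of an even power of
    [[x, 1], [1, 0]] is 1. *)
Lemma fib_value_cassini k :
  fib_value k.*2.+1 ^+ 2 =
  1 + x * fib_value k.*2 * fib_value k.*2.+1 + fib_value k.*2 ^+ 2.
Proof.
elim: k => [|k IH]; first by rewrite fib_value0 fib_value1; ring.
by rewrite doubleS !fib_valueSS; ring: IH.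
Qed.

(** The cofactor is [F_(2k+3) + F_(2k+1)], a Lucas polynomial, expressed in
    [F_(2k)] and [F_(2k+1)]. *)
Lemma fib_value_4k2 k :
  fib_value k.*2.*2.+2 =
  x + fib_value k.*2 * (x * (x * fib_value k.*2.+1 + fib_value k.*2)
                        + 2 * fib_value k.*2.+1).
Proof.
rewrite -[k.*2.*2]addnn -addnS fib_value_add fib_valueSS.
by ring: (fib_value_cassini k).
Qed.

Lemma fib_value_4k k :
  fib_value k.*2.*2 =
  fib_value k.*2 * (2 * fib_value k.*2.+1 - x * fib_value k.*2).
Proof.
have -> : fib_value k.*2.*2 = fib_value k.*2.*2.+2 - x * fib_value k.*2.*2.+1.
  by rewrite fib_valueSS; ring.
rewrite fib_value_4k2 -[k.*2.*2]addnn fib_value_add.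
by ring: (fib_value_cassini k).
Qed.

End FibonacciValues.

(** * Even points *)

(** The statement for odd [q] makes the induction go through: halving [q] turns
    [3 q + 2] into [3 (q/2) + 1] for even [q], and [3 q + 1] into [3 (q/2) + 2]
    for odd [q], each time after division by 2. The induction removes alternating
    digits until two equal ones appear, where a single factor 2 remains. *)
Lemma first_equal_digits_spec q t : t = first_equal_digits q ->
  (if odd q then (exists s, 3 * q + 1 = 2 ^ t.+1 * s.*2.+1)%N
   else (exists s, 3 * q + 2 = 2 ^ t.+1 * s.*2.+1)%N).
Proof.
rewrite /first_equal_digits; case: ex_minnP => t' eq_t min_t ->{t}.
elim: t' q eq_t min_t => [|t IH] q eq_t min_t.
  move: eq_t; rewrite /binary_digit expn0 divn1 expn1 divn2 => /eqP eq_t.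
  have eq_q := odd_double_half q; have eq_q2 := odd_double_half q./2.
  rewrite -eq_t in eq_q2; case: (odd q) eq_q eq_q2 => e1 e2.
    by exists ((3 * q./2./2) + 2)%N; lia.
  by exists (3 * q./2./2)%N; lia.
have digit_half i : binary_digit q./2 i = binary_digit q i.+1.
  by rewrite /binary_digit expnS divnMA divn2.
have := IH q./2; rewrite !digit_half => /(_ eq_t) IHq.
have {IHq} /IHq : forall n, binary_digit q./2 n == binary_digit q./2 n.+1 -> (t <= n)%N.
  by move=> n; rewrite !digit_half => /min_t.
have : odd q./2 = ~~ odd q.
  apply/eqP; rewrite -[_ == _]negbK; apply/negP => h.
  have := min_t 0%N; rewrite /binary_digit expn0 divn1 expn1 divn2.
  by case: (odd q) h; case: (odd q./2) => // _ /(_ isT).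
have eq_q := odd_double_half q.
case: (odd q) eq_q => /= e ->; case=> s es; exists s; rewrite expnS; lia.
Qed.

(** First-order information in [x = 2 y]: [F_(2k) = k x] and [F_(2k+1) = 1],
    modulo [2 x] and 4 respectively. *)
Lemma fib_value_even_form (y : adic2) k : exists z w,
  fib_value (2 * y) k.*2 = 2 * y * (k%:R + 2 * z) /\
  fib_value (2 * y) k.*2.+1 = 1 + 4 * w.
Proof.
elim: k => [|k [z [w [eu ev]]]].
  by exists 0, 0; rewrite fib_value0 fib_value1; split; ring.
exists (z + 2 * w), (w + y ^+ 2 * (k%:R + 2 * z + 1 + 4 * w)).
rewrite doubleS !fib_valueSS eu ev -[k.+1]addn1 natrD.
by split; ring.
Qed.

(** By the doubling formula, doubling the index multiplies by
    [2 F_(2k+1) - x F_(2k)], which is 2 mod 4 for even [x]. *)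
Lemma fib_value_pow2 (y : adic2) r s : exists z,
  fib_value (2 * y) (2 ^ r * s.*2.+1).*2 = 2 ^+ r * (2 * y) * (1 + 2 * z).
Proof.
elim: r => [|r [z IH]].
  rewrite mul1n; have [z [w [-> _]]] := fib_value_even_form y s.*2.+1.
  by exists (s%:R + z); rewrite -[s.*2.+1]addn1 -[s.*2]mul2n natrD natrM; ring.
rewrite expnS -mulnA mul2n fib_value_4k IH.
have [_ [w [_ ->]]] := fib_value_even_form y (2 ^ r * s.*2.+1).
set P := 2 ^+ r.
exists (z + (1 + 2 * z) * (2 * w - P * y ^+ 2 * (1 + 2 * z))).
by rewrite exprS -/P; ring.
Qed.

(** The Lucas factor in the identity for [F_(4k+2) - x] is 2 mod 4, and
    [k = 3 q + 2] contributes [2^(t+1)] through [F_(2k)]. *)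
Lemma fib_value_even_step q t (y : adic2) :
  ~~ odd q -> t = first_equal_digits q ->
  exists z, fib_value (2 * y) (10 + 12 * q) = 2 * y * (1 + 2 ^+ t.+2 * (1 + 2 * z)).
Proof.
move=> q_even /first_equal_digits_spec; rewrite (negPf q_even) => -[s es].
have -> : (10 + 12 * q = (3 * q + 2).*2.*2.+2)%N by lia.
rewrite fib_value_4k2.
have [z' [w [eu ->]]] := fib_value_even_form y (3 * q + 2).
have [z ez] := fib_value_pow2 y t.+1 s; rewrite -es in ez.
rewrite {2}eu ez; set c := (3 * q + 2)%:R.
exists (z + (1 + 2 * z) * (2 * w + y ^+ 2 * (1 + 4 * w + (c + 2 * z')))).
by rewrite [2 ^+ t.+2]exprS; ring.
Qed.

(** * Odd points *)

(** The recursion on pairs of consecutive values at [r], on natural numbers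
    reduced mod 32 so that finitely many cases can be evaluated. *)
Definition fib_mod_step (r : nat) (s : nat * nat) : nat * nat :=
  (s.2, (r * s.2 + s.1) %% 32)%N.

Definition fib_mod r m : nat := (iter m (fib_mod_step r) (0, 1)%N).1.

Lemma fib_value_residue (x : adic2) r m :
  x 5%N = Posz r -> fib_value x m 5%N = Posz (fib_mod r m).
Proof.
move=> xr; rewrite /fib_mod.
suff [] : fib_value x m 5%N = Posz (iter m (fib_mod_step r) (0, 1)%N).1 /\
          fib_value x m.+1 5%N = Posz (iter m (fib_mod_step r) (0, 1)%N).2 by [].
elim: m => [|m [e0 e1]]; first by rewrite fib_value0 fib_value1.
split; first exact: e1.
rewrite fib_valueSS residueD residueM modzDml xr e0 e1 iterS /=.
by rewrite -PoszM -PoszD modz_nat.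
Qed.

(** For odd [r] the pair of consecutive values mod 32 returns to its start after
    48 steps, so only the parity of [d] matters. *)
Lemma fib_mod_period r d : odd r -> (r < 32)%N ->
  fib_mod r (10 + 24 * d) = fib_mod r (10 + 24 * odd d).
Proof.
move=> r_odd r32.
have per : iter 48 (fib_mod_step r) (0, 1)%N = (0, 1)%N.
  have : all (fun r => odd r ==> (iter 48 (fib_mod_step r) (0, 1)%N == (0, 1)%N))
    (iota 0 32) by vm_compute.
  by move=> /allP /(_ r); rewrite mem_iota r_odd => /(_ r32)/eqP.
have -> : (10 + 24 * d = (10 + 24 * odd d) + 48 * d./2)%N.
  by have := odd_double_half d; lia.
rewrite /fib_mod iterD; congr (iter _ _ _).1.
by elim: d./2 => // k IH; rewrite mulnS iterD IH per.
Qed.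

Lemma fib_mod_table r d : odd r -> (r < 32)%N ->
  let s := fib_mod r (10 + 24 * d) in
  ((s + r) %% 16 = 8)%N /\ (fib_mod s (10 + 24 * d) = (r + 16) %% 32)%N.
Proof.
move=> r_odd r32 /=.
have : all (fun r => all (fun b : bool => odd r ==>
    let s := fib_mod r (10 + 24 * b) in
    [&& odd s, s < 32, (s + r) %% 16 == 8
      & fib_mod s (10 + 24 * b) == (r + 16) %% 32]%N) [:: true; false])
  (iota 0 32) by vm_compute.
move=> /allP /(_ r); rewrite mem_iota => /(_ r32) /allP /(_ (odd d)).
rewrite r_odd /= => H; have /H : odd d \in [:: true; false] by case: odd.
rewrite -(fib_mod_period _ r_odd r32) => /and4P[s_odd s32 /eqP e1].
by rewrite -(fib_mod_period _ s_odd s32) => /eqP e2.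
Qed.

(** Everything is determined by the residue of [x] mod 32, where a table of the
    16 odd residues and the two parities of [d] settles both congruences. *)
Lemma fib_value_odd d (x : adic2) : x 1%N = 1 ->
  let f y := fib_value y (10 + 24 * d) in
  f x 4%N = (8 - x) 4%N /\ f (f x) 5%N = (x + 16) 5%N.
Proof.
move=> x1 f; rewrite {}/f.
have [[r r32] xr _] := small_remainder 5 x; rewrite /= in xr.
have r_odd : odd r.
  have := residue_le x (isT : (1 <= 5)%N); rewrite x1 xr modz_nat.
  by rewrite modn2; case: odd.
have [e1 e2] := fib_mod_table d r_odd r32.
split; last first.
  rewrite (fib_value_residue _ (fib_value_residue _ xr)) e2 residueD xr.
  by rewrite [(16 : adic2) _]natr_residue -modz_nat.
apply/eqP; rewrite -residue_subr_eq0 opprB addrA residueD.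
rewrite [(_ + x) 4%N]residueD (residue_le (fib_value x _) (isT : (4 <= 5)%N)).
rewrite (residue_le x (isT : (4 <= 5)%N)) (fib_value_residue _ xr) xr.
by rewrite modzDm -PoszD modz_nat e1.
Qed.

(** * The components of the Fibonacci map *)

Section FibonacciDynamics.
Variables (q d t : nat).
Hypotheses (hq : q = (2 * d)%N) (ht : t = first_equal_digits q).
Let f : adic2 -> adic2 := horner (fibonacci_poly adic2 (10 + 12 * q)).

Lemma fib_odd_dynamics (x : adic2) : x 1%N = 1 ->
  f x 4%N = (8 - x) 4%N /\ f (f x) 5%N = (x + 16) 5%N.
Proof.
have e : (10 + 12 * q = 10 + 24 * d)%N by rewrite hq; lia.
by rewrite /f e; apply: fib_value_odd.
Qed.

(** The congruence for [f \o f] mod 32 contains both the exact displacement 16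
    and, being compatible with [x |-> x + 4], the condition at [x] and [x + 4]. *)
Lemma odd_coset_odometer (a : adic2) :
  a 1%N = 1 -> odometer 4 (adic2_coset a 4) (f \o f).
Proof.
move=> a1; pose F := fibonacci_poly adic2 (10 + 12 * q).
have -> : f \o f = horner (F \Po F) by apply/funext => x; rewrite horner_comp.
have step (x : adic2) : x 1%N = 1 -> exists z, (F \Po F).[x] = x + 16 + 2 ^+ 5 * z.
  by move=> x1; apply/residue_eqP; rewrite horner_comp; exact: (fib_odd_dynamics x1).2.
apply: odometer_poly => // x /(@eq_residue_le _ _ 1 4 isT); rewrite a1 => x1.
  have [z ->] := step _ x1; exists z.
  by rewrite (_ : 16 = 2 ^+ 4 :> adic2); ring.
have [z ->] := step _ x1; have [|z' ->] := step (x + 4).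
  by rewrite -x1; apply/residue_eqP; exists 2; ring.
by apply/residue_eqP; exists (2 * z' - 2 * z); ring.
Qed.

(** On this coset [x] has valuation exactly [n + 1], so that the displacement
    [2^(t+2) x (1 + 2 z)] has valuation exactly [n + 1 + t + 2]. *)
Lemma even_coset_odometer n k :
  odometer (n.+1 + t + 2) (adic2_coset ((1 + 2 * k%:R) * 2 ^+ n.+1) (n.+1 + t + 2)) f.
Proof.
have step (y : adic2) :
    exists z, f (2 * y) = 2 * y * (1 + 2 ^+ t * (4 * (1 + 2 * z))).
  have [|z e] := fib_value_even_step y _ ht; first by rewrite hq; lia.
  by exists z; apply: (etrans e); rewrite 2!(exprS 2); ring.
apply: odometer_poly => [|x /residue_eqP[w ->]|x /residue_eqP[w ->]].
- by lia.
- set u := k%:R.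
  have -> : (1 + 2 * u) * 2 ^+ n.+1 + 2 ^+ (n.+1 + t + 2) * w =
      2 * (2 ^+ n * (1 + 2 * (u + 2 * 2 ^+ t * w))).
    by rewrite !exprD exprS; ring.
  have [z] := step (2 ^+ n * (1 + 2 * (u + 2 * 2 ^+ t * w))); rewrite /f => ->.
  exists ((u + 2 * 2 ^+ t * w) + z + 2 * z * (u + 2 * 2 ^+ t * w)).
  by rewrite !exprD exprS; ring.
pose y : adic2 := 2 ^+ n * (1 + 2 * (k%:R + 2 * 2 ^+ t * w)).
have -> : (1 + 2 * k%:R) * 2 ^+ n.+1 + 2 ^+ (n.+1 + t + 2) * w = 2 * y.
  by rewrite /y !exprD exprS; ring.
have -> : 2 * y + 4 = 2 * (y + 2) by ring.
apply/residue_eqP; have [z] := step y; have [z'] := step (y + 2); rewrite /f => -> ->.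
by exists (2 ^+ t * (y * (z' - z) + 1 + 2 * z')); ring.
Qed.

Lemma A_swap k x :
  (adic2_coset (1 + 4 * k%:R) 4 x -> adic2_coset (7 - 4 * k%:R) 4 (f x)) /\
  (adic2_coset (7 - 4 * k%:R) 4 x -> adic2_coset (1 + 4 * k%:R) 4 (f x)).
Proof.
split=> -[z _ <-]; apply/adic2_cosetP; rewrite (fib_odd_dynamics _).1.
- by apply/residue_eqP; exists (- z); ring.
- by apply: (proj2 (residue_eqP _ 1 1)); exists (2 * k%:R + 8 * z); ring.
- by apply/residue_eqP; exists (- z); ring.
- by apply: (proj2 (residue_eqP _ 1 1)); exists (3 - 2 * k%:R + 8 * z); ring.
Qed.

Lemma A_odd k x : A_ k x -> x 1%N = 1.
Proof.
move=> h; apply: (proj2 (residue_eqP _ 1 1)); case: h => -[z _ <-].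
  by exists (2 * k%:R + 8 * z); ring.
by exists (3 - 2 * k%:R + 8 * z); ring.
Qed.

Lemma component_minimal i : minimal_component f (@component t i).
Proof.
case: i => [k|[n k]] /=.
  apply: swapped_cosets_minimal_component => [x|x||].
  - exact: (A_swap k x).1.
  - exact: (A_swap k x).2.
  - by apply: odd_coset_odometer; apply: (@A_odd k); left; exact: coset_refl.
  - by apply: odd_coset_odometer; apply: (@A_odd k); right; exact: coset_refl.
rewrite /M_ addn2; apply: coset_minimal_component; rewrite -addn2.
exact: even_coset_odometer.
Qed.

Lemma component_aperiodic i x n : @component t i x -> (0 < n)%N -> iter n f x <> x.
Proof.
case: i => [k|[m k]] /= xi n0; last first.
  exact: odometer_aperiodic (even_coset_odometer m k) xi n0.
move=> e.
have od := odd_coset_odometer (A_odd xi).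
apply: (odometer_aperiodic od (coset_refl _ _) n0).
(* A cycle of length n for f is one for its square: iterate it twice. *)
by rewrite iter_comp2 -addnn iterD !e.
Qed.

End FibonacciDynamics.

(** * The partition and its completeness *)

(** Membership in [M_ t n k] fixes the exponent of 2 in [x] and the first
    [t + 1] digits of [z], where [1 + 2 z] is the odd part of [x]; this is what
    separates the sets. *)
Lemma M_odd_part t n (k : 'I_(2 ^ t.+1)) x : M_ t n k x ->
  exists2 z, x = 2 ^+ n * (1 + 2 * z) & z t.+1 = Posz k.
Proof.
case=> z _ <-; exists (k%:R + 2 ^+ t.+1 * z).
  by rewrite !exprD (exprS _ t); ring.
transitivity ((k%:R : adic2) t.+1); first by apply/residue_eqP; exists z.
rewrite natr_residue modz_small //=.
by have := ltn_ord k; rewrite -ltz_nat -[Posz (2 ^ _)]natz natrX.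
Qed.

Lemma zero_notin_component t (i : 'I_4 + nat * 'I_(2 ^ t.+1)) : ~ @component t i 0.
Proof.
case: i => [k /A_odd //|[n k] /= /M_odd_part[z /esym z0 _]].
exact: pow2_odd_neq0 z0.
Qed.

Lemma component_disjoint t : trivIset setT (@component t).
Proof.
have AM k n (k' : 'I_(2 ^ t.+1)) x : A_ k x -> M_ t n.+1 k' x -> False.
  move=> /A_odd x1 /M_odd_part[z xz _]; have [x0 _] := pow2_odd_residue n.+1 z.
  by move: x1; rewrite xz (residue_le _ (isT : (1 <= n.+1)%N)) x0.
move=> [k|[n k]] [k'|[n' k']] _ _ [x [/= xk xk']].
- have residue4 (j : 'I_4) : A_ j x ->
      x 4%N = Posz (1 + 4 * j) \/ x 4%N = Posz ((23 - 4 * j) %% 16).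
    have j4 := ltn_ord j; case=> /adic2_cosetP ->; [left|right].
      have -> : 1 + 4 * j%:R = (1 + 4 * j)%:R :> adic2 by rewrite natrD natrM.
      by rewrite natr_residue modz_small //; lia.
    (* 23 = 7 + 16 keeps the subtraction on natural numbers exact. *)
    have -> : Posz ((23 - 4 * j) %% 16) = ((23 - 4 * j)%:R : adic2) 4%N.
      by rewrite natr_residue modz_nat.
    apply/residue_eqP; exists (- 1); rewrite natrB; last by lia.
    by rewrite natrM; ring.
  congr inl; apply: val_inj => /=.
  have k4 := ltn_ord k; have k4' := ltn_ord k'.
  by case: (residue4 _ xk) (residue4 _ xk') => -> [] []; lia.
- by have := AM _ _ _ _ xk xk'.
- by have := AM _ _ _ _ xk' xk.
have [z xz zk] := M_odd_part xk; have [z' xz' zk'] := M_odd_part xk'.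
have [[en] ez] := pow2_odd_uniq (etrans (esym xz) xz').
subst n' z'; congr (inr (_, _)); apply: val_inj.
by move: zk'; rewrite zk => -[].
Qed.

Lemma component_cover t x : x <> 0 -> exists i, @component t i x.
Proof.
move=> /pow2_odd_decomp[[|n] [z ->]].
  rewrite mul1r; have [[y ->]|[y ->]] := even_or_odd z.
    have [r _ [w ->]] := small_remainder 2 y.
    by exists (inl r); left; exists w => //=; ring.
  (* [1 + 2 (1 + 2 y) = 7 - 4 (1 - y)] *)
  have [r _ [w yw]] := small_remainder 2 (1 - y).
  have -> : y = 1 - (r%:R + 2 ^+ 2 * w) by rewrite -yw; ring.
  by exists (inl r); right; exists (- w) => //=; ring.
have [r _ [w ->]] := small_remainder t.+1 z.
exists (inr (n, r)) => /=; exists w => //.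
by rewrite !exprD (exprS _ t); ring.
Qed.

(** An open set contains a point [y] other than 0, hence a point of some
    listed component; both sets are then the closure of the orbit of [y]. *)
Lemma component_complete f t S :
  (forall i, minimal_component f (@component t i)) ->
  minimal_component f S -> exists i, @component t i = S.
Proof.
move=> compM [[x Sx] [oS cS] _ SS Smin].
have orbit_sub T y : closed T -> invariant_set f T -> T y ->
    closure (orbit_of f y) `<=` T.
  move=> cT TT Ty; rewrite [X in _ `<=` X](closure_id _).1//.
  apply: closureS => _ [n _ <-].
  by elim: n => //= n IH; apply: TT; exists (iter n f y).
have [y Sy /(component_cover t)[i yi]] : exists2 y, S y & y <> 0.
  have [x0|] := pselect (x = 0); last by exists x.
  move: oS; rewrite openE => /(_ _ Sx)/nbhs_adic2P[n nS].
  exists (2 ^+ n * (1 + 2 * 0)); last exact: pow2_odd_neq0.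
  by apply: nS; exists (1 + 2 * 0); rewrite // x0 add0r.
have [_ [_ cM] _ MM Mmin] := compM i.
exists i; apply/seteqP; split.
  exact: subset_trans (Mmin _ yi) (orbit_sub _ _ cS SS Sy).
exact: subset_trans (Smin _ Sy) (orbit_sub _ _ cM MM yi).
Qed.

Theorem theorem9p2 (m q d t : nat) (hm : m = (10 + 12 * q)%N)
    (hq : q = (2 * d)%N) (ht : t = first_equal_digits q) :
  (fibonacci_poly adic2 m).[0] = 0 /\
  minimal_decomposition (fibonacci_poly adic2 m) [set 0] (@component t) set0.
Proof.
set f := horner _.
have compM i : minimal_component f (@component t i).
  by rewrite /f hm; exact: component_minimal hq ht i.
have f0 : f 0 = 0.
  rewrite /f hm (_ : 10 + 12 * q = (5 + 6 * q).*2)%N; last by lia.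
  have [z [_ [e _]]] := fib_value_even_form 0 (5 + 6 * q).
  by move: e; rewrite mulr0 mul0r.
split=> //; split.
- split; rewrite ?setU0 ?setI0//.
    apply/seteqP; split=> // x _; have [->|x0] := pselect (x = 0); first by left.
    by right; have [i xi] := component_cover t x0; exists i.
  by apply/seteqP; split=> // x [-> [i _ /zero_notin_component]].
- split; first exact: finite_set1.
  apply/seteqP; split=> [_ -> /=|x [n n0 fx]]; first by exists 1%N.
  apply: contrapT => /(component_cover t)[i xi].
  by move: fx; rewrite hm; exact: component_aperiodic hq ht _ _ _ xi n0.
- exact: component_disjoint.
- by move=> S; split=> [/(component_complete compM)//|[i <-]].
- by [].
Qed.
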